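(* Let $1\le k\le n$, let $\mathcal S\subset\mathcal P_n$ be the stabilizer group of a stabilizer code, $D$ a decoding map, and $\tilde G\subset\tilde{\mathcal P}_n$ a nontrivial subgroup. Assume $p_{\rm QEC}=0$ and $p_{\rm DD}\in[0,1)$. Then for any $z>0$ (where $z=p/(3-3p)$, $p\in(0,1)$), $$F_{\rm Hyb}>F_{\rm QEC}\iff \frac{W(V\setminus K;z)}{W(V;z)}>\frac{W(U\setminus K;z)}{W(U;z)},$$ where $F_{\rm Hyb}$ and $F_{\rm QEC}$ are the fidelities of the hybrid LDD+QEC protocol and of the QEC-only protocol, and $K$, $U$, $V$ are the sets of correctable, unsuppressed and suppressed errors defined in the context.
   Context: Paulis. $\mathcal P_n$ is the $n$-qubit Pauli group (with phases $\pm1,\pm i$), $\tilde{\mathcal P}_n=\mathcal P_n/\langle iI\rangle$, and $\pi:\mathcal P_n\to\tilde{\mathcal P}_n$ is the projection. Elements of $\tilde{\mathcal P}_n$ are represented by strings in $\{I,X,Y,Z\}^n$; $\mathrm{wt}(E')$ is the number of non-identity letters. Two elements of $\tilde{\mathcal P}_n$ are said to commute (anticommute) if their representatives in $\mathcal P_n$ do. Code. $\mathcal S\subset\mathcal P_n$ is a subgroup with $2^{n-k}$ elements not containing $-I$, and $C(\mathcal S)$ is its centralizer in $\mathcal P_n$. $\mathcal S^*$ is the $\mathbb F_2$-dual of $\mathcal S$; the syndrome $\mathrm{syn}(E')\in\mathcal S^*$ is given by $\mathrm{syn}(E')(s)=1$ iff $E'$ anticommutes with $s$. A decoding map is a map $D:\mathcal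 S^*\to\tilde{\mathcal P}_n$ with $D(0)=\pi(I)$ and $\mathrm{syn}(D(\sigma))=\sigma$ for all $\sigma$. Sets. $T=\pi(\mathcal S)$; $K=\{E'\in\tilde{\mathcal P}_n: D(\mathrm{syn}(E'))E'\in T\}$ (correctable errors); $U=\tilde G^\perp=\{E'\in\tilde{\mathcal P}_n: E'\text{ commutes with every element of }\tilde G\}$ (unsuppressed errors); $V=\tilde{\mathcal P}_n\setminus U$ (suppressed errors). For $A\subset\tilde{\mathcal P}_n$, $W(A;z)=\sum_{E'\in A}z^{\mathrm{wt}(E')}$. Hybrid LDD+QEC protocol. A random error $E'\in\tilde{\mathcal P}_n$ is drawn from the distribution obtained from $(1-p)^{n-\mathrm{wt}(E')}(p/3)^{\mathrm{wt}(E')}$ by multiplying the probabilities of all $E'\in V$ by $p_{\rm DD}$ and renormalizing. The syndrome $\sigma=\mathrm{syn}(E')$ is measured. If $\sigma=0$, the recovery is $R=\pi(I)$. If $\sigma\ne0$, then with probability $1-p_{\rm QEC}$ the recovery is $R=D(\sigma)$, and with probability $p_{\rm QEC}$ it is a uniformly random $R\in\tilde{\mathcal P}_n$ with $\mathrm{syn}(R)=\sigma$. $F_{\rm Hyb}$ is the probability that $RE'\in T$ (no logical error). The QEC-only protocol is the same with no rescaling by decoupling, i.e. with $p_{\rm DD}$ replaced by $1$, and $F_{\rm QEC}$ is its fidelity. *)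

(* Defs.v *)
From HB Require Import structures.
From mathcomp Require Import all_boot all_order all_algebra all_fingroup all_solvable.

Set Implicit Arguments.
Unset Strict Implicit.
Unset Printing Implicit Defensive.

Import Order.TTheory GRing.Theory Num.Theory.
Local Open Scope ring_scope.

Inductive letter : predArgType := LI | LX | LY | LZ.

Definition ord_of_letter (a : letter) : 'I_4 :=
  match a with LI => inord 0 | LX => inord 1 | LY => inord 2 | LZ => inord 3 end.

Definition letter_of_ord (i : 'I_4) : letter :=
  match val i with 0%N => LI | 1%N => LX | 2%N => LY | _ => LZ end.

Lemma ord_of_letterK : cancel ord_of_letter letter_of_ord.
Proof. by case; rewrite /letter_of_ord /= inordK. Qed.

HB.instance Definition _ := Finite.copy letter (can_type ord_of_letterK).

(* The product of two letters modulo phases. *)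
Definition letter_mul (a b : letter) : letter :=
  match a, b with
  | LI, c | c, LI => c
  | LX, LX | LY, LY | LZ, LZ => LI
  | LX, LY | LY, LX => LZ
  | LY, LZ | LZ, LY => LX
  | LZ, LX | LX, LZ => LY
  end.

Lemma letter_mulA : associative letter_mul. Proof. by do 3!case. Qed.
Lemma letter_mul1 : left_id LI letter_mul. Proof. by case. Qed.
Lemma letter_mulV : left_inverse LI id letter_mul. Proof. by case. Qed.

HB.instance Definition _ :=
  Finite_isGroup.Build letter letter_mulA letter_mul1 letter_mulV.

(* The product of the Pauli matrices of a and b is i ^ (letter_phase a b) times
   the Pauli matrix of letter_mul a b; see letter_mx_mul. *)
Definition letter_phase (a b : letter) : 'Z_4 :=
  match a, b with
  | LX, LY | LY, LZ | LZ, LX => 1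
  | LY, LX | LZ, LY | LX, LZ => 3
  | _, _ => 0
  end.

Definition letter_mx (C : numClosedFieldType) (a : letter) : 'M[C]_2 :=
  \matrix_(r, c)
    match a with
    | LI => (r == c)%:R
    | LX => (r != c)%:R
    | LY => if r == c then 0 else if r == 0 then - 'i else 'i
    | LZ => if r == c then (if r == 0 then 1 else -1) else 0
    end.

Lemma letter_mx_mul (C : numClosedFieldType) (a b : letter) :
  letter_mx C a *m letter_mx C b =
  'i ^+ letter_phase a b *: letter_mx C (a * b)%g.
Proof.
have i3 : 'i ^+ 3 = - 'i :> C by rewrite exprS sqrCi mulrN1.
have ii : 'i * 'i = -1 :> C by rewrite -expr2 sqrCi.
apply/matrixP => r c; rewrite !mxE !big_ord_recl big_ord0 !mxE.
case: r => [[|[|//]] hr]; case: c => [[|[|//]] hc]; case: a; case: b => /=;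
  rewrite ?expr0 ?expr1 ?i3 ?mul0r ?mulr0 ?mul1r ?mulr1 ?addr0 ?add0r
    ?mulrN ?mulNr ?mulr1 ?mul1r ?ii ?opprK ?oppr0 //.
Qed.

(* Elements of the Pauli group modulo phases, as strings of letters; the group
   law is the componentwise product of letters. *)
Notation pstring n := {dffun forall i : 'I_n, letter}.

(* PauliOp a P is the operator i ^ a * (P_1 (x) ... (x) P_n). *)
Record pauli (n : nat) : predArgType :=
  PauliOp { phase : 'Z_4; letters : pstring n }.

Section PauliGroup.
Variable n : nat.
Implicit Types (g h : pauli n) (E F : pstring n).

Definition pair_of_pauli g := (phase g, letters g).
Definition pauli_of_pair (u : 'Z_4 * pstring n) := PauliOp u.1 u.2.
Lemma pair_of_pauliK : cancel pair_of_pauli pauli_of_pair.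
Proof. by case. Qed.

HB.instance Definition _ := Finite.copy (pauli n) (can_type pair_of_pauliK).

Definition string_phase E F : 'Z_4 := \sum_(j < n) letter_phase (E j) (F j).

Definition pauli_mul g h : pauli n :=
  PauliOp (phase g + phase h + string_phase (letters g) (letters h))
          (letters g * letters h)%g.
Definition pauli_one : pauli n := PauliOp 0 1%g.
Definition pauli_inv g : pauli n :=
  PauliOp (- phase g) (letters g).

Lemma pauli_mulA : associative pauli_mul.
Proof.
move=> [a P] [b Q] [c S]; rewrite /pauli_mul /= mulgA; congr PauliOp.
have cocycle : string_phase Q S + string_phase P (Q * S)%g =
               string_phase P Q + string_phase (P * Q)%g S.
  rewrite -!big_split; apply: eq_bigr => j _; rewrite !mulg_ffun.
  by apply: val_inj; case: (P j); case: (Q j); case: (S j).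
rewrite !addrA -[LHS]addrA [in LHS]cocycle addrA; congr (_ + _).
by rewrite -!addrA (addrC c).
Qed.

Lemma pauli_mul1 : left_id pauli_one pauli_mul.
Proof.
move=> [a P]; rewrite /pauli_mul /= mul1g add0r /string_phase big1 ?addr0 //.
by move=> j _; rewrite oneg_ffun.
Qed.

Lemma pauli_mulV : left_inverse pauli_one pauli_inv pauli_mul.
Proof.
move=> [a P]; rewrite /pauli_mul /pauli_one /= addNr add0r; congr PauliOp.
  by rewrite /string_phase big1 // => j _; case: (P j).
by apply/ffunP => j; rewrite mulg_ffun oneg_ffun; case: (P j).
Qed.

HB.instance Definition _ :=
  Finite_isGroup.Build (pauli n) pauli_mulA pauli_mul1 pauli_mulV.

(* The entries of the 2^n x 2^n matrix of g, i.e. of a tensor product of 2 x 2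
   matrices, with rows and columns indexed by functions from 'I_n to 'I_2. *)
Definition pauli_entry (C : numClosedFieldType) g (x y : {ffun 'I_n -> 'I_2}) : C :=
  'i ^+ phase g * \prod_(j < n) letter_mx C (letters g j) (x j) (y j).

Lemma expCi_D4 (C : numClosedFieldType) (a b : 'Z_4) :
  'i ^+ (a + b)%R = 'i ^+ a * 'i ^+ b :> C.
Proof.
have i4 : 'i ^+ 4 = 1 :> C by rewrite (exprM _ 2 2) sqrCi sqrrN expr1n.
by rewrite /= expr_mod // exprD.
Qed.

Lemma pauli_entry_mul (C : numClosedFieldType) g h (x z : {ffun 'I_n -> 'I_2}) :
  pauli_entry C (g * h)%g x z =
  \sum_y pauli_entry C g x y * pauli_entry C h y z.
Proof.
have phaseM : 'i ^+ phase (g * h)%g = 'i ^+ phase g * 'i ^+ phase h *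
    'i ^+ string_phase (letters g) (letters h) :> C by rewrite -!expCi_D4.
rewrite /pauli_entry phaseM; under [in RHS]eq_bigr => y _ do rewrite mulrACA -big_split /=.
rewrite -mulr_sumr -(bigA_distr_bigA (fun j (k : 'I_2) =>
  letter_mx C (letters g j) (x j) k * letter_mx C (letters h j) k (z j))) /=.
have entryM j : \sum_(k < 2) letter_mx C (letters g j) (x j) k *
      letter_mx C (letters h j) k (z j) =
    'i ^+ letter_phase (letters g j) (letters h j) *
    letter_mx C ((letters g * letters h)%g j) (x j) (z j).
  move/matrixP: (letter_mx_mul C (letters g j) (letters h j)) => /(_ (x j) (z j)).
  by rewrite [LHS]mxE mulg_ffun [RHS]mxE.
under [in RHS]eq_bigr => j _ do rewrite entryM.
rewrite big_split /= mulrA; congr (_ * _ * _).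
by apply: (big_morph (fun a : 'Z_4 => 'i ^+ a)) => // a b; rewrite expCi_D4.
Qed.

Definition minus_I : pauli n := PauliOp 2 1%g.
Definition i_I : pauli n := PauliOp 1 1%g.

(* pi : P_n -> P_n / <iI> *)
Definition pauli_pi g : pstring n := letters g.

Lemma pauli_piM : {in setT &, {morph pauli_pi : g h / (g * h)%g}}.
Proof. by []. Qed.

Canonical pauli_pi_morphism := Morphism pauli_piM.

Lemma im_pauli_pi : (pauli_pi @* setT)%g = setT.
Proof.
apply/setP => E; rewrite inE; apply/morphimP.
by exists (PauliOp 0 E); rewrite ?inE.
Qed.

Lemma expg_i_I m : (i_I ^+ m)%g = PauliOp m%:R 1%g.
Proof.
elim: m => [|m IHm]; first by rewrite expg0.
rewrite expgS IHm; congr PauliOp; last by rewrite /= mulg1.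
rewrite /= /string_phase big1 ?addr0 -?mulrS //.
by move=> j _; rewrite oneg_ffun.
Qed.

Lemma ker_pauli_pi : ('ker pauli_pi)%g = <[i_I]>%g.
Proof.
apply/setP => -[a P]; rewrite !inE /=; apply/eqP/cycleP => [-> | [m]].
  by exists a; rewrite expg_i_I natr_Zp.
by rewrite expg_i_I => -[_ ->].
Qed.

Definition pauli_lift E : pauli n := PauliOp 0 E.

Definition wt E : nat := #|[set j | E j != LI]|.

Definition anticommute g h : bool := (g * h == minus_I * (h * g))%g.

Definition pcommute E F : bool :=
  (pauli_lift E * pauli_lift F == pauli_lift F * pauli_lift E)%g.

Lemma pauli_eqE g h : (g == h) = (phase g == phase h) && (letters g == letters h).
Proof.
case: g h => [a P] [b Q] /=.
by apply/eqP/andP => [[-> ->]|[/eqP-> /eqP->]].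
Qed.

Lemma phaseM g h :
  phase (g * h)%g = phase g + phase h + string_phase (letters g) (letters h).
Proof. by []. Qed.

Lemma lettersM g h : letters (g * h)%g = (letters g * letters h)%g.
Proof. by []. Qed.

Lemma string_phase1 E : string_phase 1%g E = 0.
Proof. by rewrite /string_phase big1 // => j _; rewrite oneg_ffun. Qed.

(* Commutation does not depend on the choice of representatives. *)
Lemma commute_pi g h :
  (g * h == h * g)%g = pcommute (pauli_pi g) (pauli_pi h).
Proof.
rewrite /pcommute !pauli_eqE !lettersM !phaseM (addrC (phase h)).
by rewrite (inj_eq (addrI _)) (addrC (phase (pauli_lift (pauli_pi h))))
  (inj_eq (addrI _)).
Qed.

Lemma anticommute_pi g h :
  anticommute g h = anticommute (pauli_lift (pauli_pi g)) (pauli_lift (pauli_pi h)).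
Proof.
have aux (a b c d e : 'Z_4) : (a + b + c == e + (b + a + d)) = (c == e + d).
  by rewrite (addrCA e) (addrC b) (inj_eq (addrI _)).
have key g' h' : anticommute g' h' =
    (string_phase (letters g') (letters h') ==
     phase minus_I + string_phase (letters h') (letters g')) &&
    (letters g' * letters h' == letters h' * letters g')%g.
  by rewrite /anticommute pauli_eqE !lettersM !phaseM string_phase1 mul1g addr0 aux.
by rewrite !key.
Qed.

End PauliGroup.

Arguments pauli_pi {n} g.


Section Anticommutation.
Variable n : nat.
Implicit Types g h s t : pauli n.

Lemma minus_I_central g : (minus_I n * g = g * minus_I n)%g.
Proof.
apply/eqP; rewrite pauli_eqE !lettersM !phaseM mulg1 mul1g eqxx andbT.
by rewrite (addrC (phase g)) /string_phase !big1 // => j _;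
  rewrite oneg_ffun //; case: (letters g j).
Qed.

Lemma minus_I_sqr : (minus_I n * minus_I n = 1)%g.
Proof.
apply/eqP; rewrite pauli_eqE lettersM phaseM mulg1 eqxx andbT.
by rewrite string_phase1.
Qed.

Lemma minus_I_neq1 : minus_I n != 1%g.
Proof. by rewrite pauli_eqE. Qed.

Lemma commute_or_anticommute g h : (g * h == h * g)%g || anticommute g h.
Proof.
pose d : 'Z_4 := string_phase (letters g) (letters h) -
                 string_phase (letters h) (letters g).
have d2 : d *+ 2 = 0.
  rewrite /d /string_phase -sumrB -sumrMnl big1 // => j _.
  by apply: val_inj; case: (letters g j); case: (letters h j).
have mulC : (letters g * letters h = letters h * letters g)%g.
  apply/ffunP => j; rewrite !mulg_ffun.
  by case: (letters g j); case: (letters h j).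
have sph : string_phase (letters g) (letters h) =
           d + string_phase (letters h) (letters g) by rewrite subrK.
have addIE (x y z : 'Z_4) : (x + z == y + z) = (x == y) by apply: inj_eq (addIr z) _ _.
rewrite /anticommute !pauli_eqE !lettersM !phaseM string_phase1 mul1g addr0.
rewrite mulC eqxx !andbT sph (addrC (phase h)) (addrCA (phase (minus_I n))).
rewrite !(inj_eq (addrI _)) addIE -subr_eq0 addrK.
by case: {sph} d d2 => [[|[|[|[|//]]]] hd] => /(congr1 val).
Qed.

Lemma anticommuteN g h : anticommute g h = ~~ (g * h == h * g)%g.
Proof.
have := commute_or_anticommute g h; rewrite /anticommute.
case: eqP => [-> _|_ /= -> //].
by apply/negbTE; rewrite -{1}(mul1g (h * g)%g) eq_sym (can_eq (mulgK _)) minus_I_neq1.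
Qed.

Lemma anticommuteM g s t :
  anticommute g (s * t)%g = anticommute g s (+) anticommute g t.
Proof.
have gst (x y : pauli n) : (g * s = x * (s * g))%g -> (g * t = y * (t * g))%g ->
    (s * y = y * s)%g -> (g * (s * t) = x * y * (s * t * g))%g.
  by move=> hs ht sy; rewrite mulgA hs -!mulgA ht (mulgA s y) sy !mulgA.
have c1 (x : pauli n) : (x * 1 = 1 * x)%g by rewrite mulg1 mul1g.
have cI (x : pauli n) : (x * minus_I n = minus_I n * x)%g by rewrite minus_I_central.
have hC (x : pauli n) : anticommute g x = false -> (g * x = 1 * (x * g))%g.
  by rewrite anticommuteN mul1g => /negbFE/eqP.
have hA (x : pauli n) : anticommute g x = true -> (g * x = minus_I n * (x * g))%g.
  by move/eqP.
case es : (anticommute g s); case et : (anticommute g t) => /=.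
- by rewrite anticommuteN (gst _ _ (hA _ es) (hA _ et) (cI s)) minus_I_sqr mul1g eqxx.
- by apply/eqP; rewrite (gst _ _ (hA _ es) (hC _ et) (c1 s)) mulg1.
- by apply/eqP; rewrite (gst _ _ (hC _ es) (hA _ et) (cI s)) mul1g.
- by rewrite anticommuteN (gst _ _ (hC _ es) (hC _ et) (c1 s)) !mul1g eqxx.
Qed.

End Anticommutation.

(* The F_2-dual of S: group homomorphisms from S to 'F_2. *)
Section Dual.
Variables (gT : finGroupType) (S : {group gT}).

Definition is_dual : pred {ffun [subg S] -> 'F_2} :=
  [pred f : {ffun [subg S] -> 'F_2} |
    [forall s, forall t, f (s * t)%g == f s + f t]].

Lemma is_dualP (f : {ffun [subg S] -> 'F_2}) :
  reflect {morph f : s t / (s * t)%g >-> s + t} (f \in is_dual).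
Proof.
rewrite inE; apply: (iffP forallP) => [h s t | h s].
  by apply/eqP; move/forallP: (h s).
by apply/forallP => t; rewrite h.
Qed.

Lemma is_dual_zmod_closed : zmod_closed is_dual.
Proof.
split=> [|f1 f2 /is_dualP h1 /is_dualP h2]; apply/is_dualP => s t.
  by rewrite !ffunE addr0.
by rewrite !ffunE h1 h2 opprD addrACA.
Qed.

HB.instance Definition _ :=
  GRing.isZmodClosed.Build {ffun [subg S] -> 'F_2} is_dual is_dual_zmod_closed.

Record dual : predArgType :=
  Dual { dual_val :> {ffun [subg S] -> 'F_2}; _ : dual_val \in is_dual }.

HB.instance Definition _ := [isSub for dual_val].
HB.instance Definition _ := [Finite of dual by <:].
HB.instance Definition _ := [SubChoice_isSubZmodule of dual by <:].

End Dual.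

Arguments is_dual {gT} S f.

Section Code.
Variables (n : nat) (S : {group pauli n}).
Implicit Types (E F : pstring n) (A : {set pstring n}) (D : dual S -> pstring n).

Definition syn_val E : {ffun [subg S] -> 'F_2} :=
  [ffun s : [subg S] => (anticommute (pauli_lift E) (sgval s))%:R].

Lemma syn_subproof E : syn_val E \in is_dual S.
Proof.
apply/is_dualP => s t; rewrite !ffunE anticommuteM.
by case: anticommute; case: anticommute; apply: val_inj.
Qed.

Definition syn E : dual S := Dual (syn_subproof E).

Definition is_decoding_map D : Prop :=
  D 0 = pauli_pi 1%g /\ forall sigma, syn (D sigma) = sigma.

Definition stab_strings : {set pstring n} := (pauli_pi @* S)%g.

Definition correctable D : {set pstring n} :=
  [set E | (D (syn E) * E)%g \in stab_strings].

End Code.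

Definition unsuppressed n (G : {group pstring n}) : {set pstring n} :=
  [set E | [forall F in G, pcommute E F]].

Definition suppressed n (G : {group pstring n}) : {set pstring n} := ~: unsuppressed G.

Definition W (R : realFieldType) n (A : {set pstring n}) (z : R) : R :=
  \sum_(E in A) z ^+ wt E.

Section Protocol.
Variables (R : realFieldType) (n : nat) (S : {group pauli n}).
Variables (D : dual S -> pstring n) (G : {group pstring n}).
Variables (p pDD pQEC : R).
Implicit Types (E Q : pstring n) (sigma : dual S).

Definition dd_weight E : R :=
  (1 - p) ^+ (n - wt E) * (p / 3) ^+ wt E * (if E \in suppressed G then pDD else 1).

Definition error_prob E : R := dd_weight E / \sum_F dd_weight F.

(* The conditional probability of the recovery Q given the syndrome sigma. *)
Definition recovery_prob sigma Q : R :=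
  if sigma == 0 then (Q == pauli_pi 1%g)%:R
  else (1 - pQEC) * (Q == D sigma)%:R +
       pQEC * (if syn S Q == sigma
               then #|[set Q' | syn S Q' == sigma]|%:R^-1 else 0).

Definition F_Hyb : R :=
  \sum_E \sum_(Q | (Q * E)%g \in stab_strings S)
    error_prob E * recovery_prob (syn S E) Q.

End Protocol.

Definition F_QEC (R : realFieldType) n (S : {group pauli n})
    (D : dual S -> pstring n) (G : {group pstring n}) (p pQEC : R) : R :=
  F_Hyb D G p 1 pQEC.

(* Main.v *)
Require Import Defs.
From mathcomp Require Import all_boot all_order all_algebra all_fingroup.
From mathcomp Require Import ring lra.

(** When [pQEC = 0] the recovery is the decoding map itself, so [F_Hyb] is the
    probability of [K].  Up to the factor [(1 - p) ^+ n] the weight of an error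
    [E] is [z ^+ wt E], times [pDD] on [V]; hence, with [a], [b], [u], [v] the
    enumerators of [U :&: K], [V :&: K], [U], [V] at [z],
    [F_Hyb = (a + pDD * b) / (u + pDD * v)].  Since [u, v > 0] (where [v > 0]
    because the commutation pairing is nondegenerate), both sides of the
    equivalence amount to [b * u < a * v]. *)

Set Implicit Arguments.
Unset Strict Implicit.
Unset Printing Implicit Defensive.

Import Order.TTheory GRing.Theory Num.Theory.
Local Open Scope ring_scope.

Section Strings.
Variable n : nat.
Implicit Types (E F : pstring n) (G : {group pstring n}) (A B : {set pstring n}).

(** Letters commute modulo phases, so only the phases of the two products can differ. *)
Lemma pcommuteE E F :
  pcommute E F = (string_phase E F == string_phase F E).
Proof.
rewrite /pcommute pauli_eqE /= !add0r.
suff -> : (E * F = F * E)%g by rewrite eqxx andbT.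
by apply/ffunP => j; rewrite !mulg_ffun; case: (E j); case: (F j).
Qed.

Definition single_letter (j : 'I_n) (a : letter) : pstring n :=
  [ffun i => if i == j then a else LI].

Lemma string_phase_singlel j a F :
  string_phase (single_letter j a) F = letter_phase a (F j).
Proof.
rewrite /string_phase (bigD1 j) //= ffunE eqxx big1 ?addr0 // => i ij.
by rewrite ffunE (negbTE ij).
Qed.

Lemma string_phase_singler j a F :
  string_phase F (single_letter j a) = letter_phase (F j) a.
Proof.
rewrite /string_phase (bigD1 j) //= ffunE eqxx big1 ?addr0 // => i ij.
by rewrite ffunE (negbTE ij); case: (F i).
Qed.

Lemma pcommute_nondegenerate F : F != 1%g -> exists E, ~~ pcommute E F.
Proof.
move=> F1; have [j Fj] : exists j, F j != LI.
  apply/existsP; rewrite -negb_forall; apply: contra F1 => /forallP FI.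
  by apply/eqP/ffunP => j; rewrite oneg_ffun (eqP (FI j)).
(* Only site [j] contributes to the phases, and two distinct non-identity letters anticommute
   there. *)
exists (single_letter j (if F j is LX then LY else LX)).
rewrite pcommuteE string_phase_singlel string_phase_singler.
by case: (F j) Fj => //; rewrite ?eqxx.
Qed.

Lemma unsuppressed1 G : 1%g \in unsuppressed G.
Proof.
by rewrite inE; apply/forallP=> F; apply/implyP => _; rewrite /pcommute mul1g mulg1.
Qed.

Lemma suppressed_neq0 G : G :!=: 1%g -> exists E, E \in suppressed G.
Proof.
case/trivgPn => F FG F1; have [E EF] := pcommute_nondegenerate F1; exists E.
rewrite !inE; apply/forallPn; exists F.
by rewrite negb_imply FG.
Qed.

Lemma wt_le E : (wt E <= n)%N.
Proof. by rewrite -[leqRHS]card_ord max_card. Qed.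

Variable R : realFieldType.

Lemma W_gt0 A E (z : R) : 0 < z -> E \in A -> 0 < W A z.
Proof.
move=> z0 EA; rewrite /W (bigD1 E) //= ltr_pwDl ?exprn_gt0 //.
by apply: sumr_ge0 => F _; rewrite exprn_ge0 // ltW.
Qed.

Lemma W_setID A B (z : R) : W A z = W (A :&: B) z + W (A :\: B) z.
Proof. by rewrite /W (big_setID B). Qed.

End Strings.

Section Fidelity.
Variables (R : realFieldType) (n : nat) (S : {group pauli n}).
Variables (D : dual S -> pstring n) (G : {group pstring n}).
Variables (p z : R).
Hypotheses (p_lt1 : p < 1) (zE : z = p / (3 - 3 * p)).
Implicit Types (A : {set pstring n}) (E : pstring n) (d : R).

Lemma dd_weightE d E :
  dd_weight G p d E =
  (1 - p) ^+ n * (z ^+ wt E * (if E \in suppressed G then d else 1)).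
Proof.
rewrite /dd_weight mulrA; congr (_ * _).
have q0 : 1 - p != 0 by rewrite subr_eq0 gt_eqF.
(* Each of the [wt E] factors [p / 3] yields one [z] and one [1 - p]; the latter complete the power
   [n - wt E] to [n]. *)
have -> : p / 3 = z * (1 - p).
  have -> : z = p / (3 * (1 - p)) by rewrite zE mulrBr mulr1.
  by field.
by rewrite exprMn mulrCA -exprD subnK ?wt_le // mulrC.
Qed.

(** Needed for [correctable D] (numerator of the fidelity) and for [setT] (normalization). *)
Lemma sum_dd_weight d A :
  \sum_(E in A) dd_weight G p d E =
  (1 - p) ^+ n * (W (unsuppressed G :&: A) z + d * W (suppressed G :&: A) z).
Proof.
under eq_bigr do rewrite dd_weightE.
rewrite -mulr_sumr (big_setID (suppressed G)) /= addrC; congr (_ * (_ + _)).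
  rewrite setDE setCK setIC; apply: eq_bigr => E /setIP[EU _].
  by rewrite in_setC EU mulr1.
rewrite /W mulr_sumr setIC; apply: eq_bigr => E /setIP[-> _].
by rewrite mulrC.
Qed.

(** The case [sigma = 0] fits the general formula because [D 0] is the identity string. *)
Lemma recovery_prob0 (hD : is_decoding_map D) sigma Q :
  recovery_prob D (0 : R) sigma Q = (Q == D sigma)%:R.
Proof.
rewrite /recovery_prob; case: eqP => [->|_]; first by rewrite hD.1.
by rewrite subr0 mul1r mul0r addr0.
Qed.

Lemma F_Hyb_correctable (hD : is_decoding_map D) d :
  F_Hyb D G p d 0 = \sum_(E in correctable D) error_prob G p d E.
Proof.
rewrite /F_Hyb [RHS]big_mkcond; apply: eq_bigr => E _.
under eq_bigr do rewrite recovery_prob0 // -mulr_natr.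
(* Only [Q = D (syn S E)] has nonzero probability; it occurs in the inner sum exactly when [E] is
   correctable. *)
rewrite inE; case: ifP => ES.
  rewrite (bigD1 (D (syn S E))) //= eqxx big1 ?addr0 ?mulr1 // => Q /andP[_ /negbTE ->].
  by rewrite !(mul0r, mulr0).
rewrite big1 // => Q QS; case: eqP QS => [->|_ _]; first by rewrite ES.
by rewrite !(mul0r, mulr0).
Qed.

Lemma F_HybE (hD : is_decoding_map D) d :
  F_Hyb D G p d 0 =
  (W (unsuppressed G :&: correctable D) z + d * W (suppressed G :&: correctable D) z)
  / (W (unsuppressed G) z + d * W (suppressed G) z).
Proof.
rewrite F_Hyb_correctable // -mulr_suml sum_dd_weight.
have := sum_dd_weight d setT.
rewrite (eq_bigl xpredT) => [|E]; last by rewrite in_setT.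
rewrite !setIT => ->.
by rewrite -mulf_div divff ?mul1r // expf_neq0 // subr_eq0 gt_eqF.
Qed.

End Fidelity.

Lemma mediant_lt (R : realFieldType) (a b u v d : R) :
  0 < u -> 0 < v -> 0 <= d < 1 ->
  ((a + b) / (u + v) < (a + d * b) / (u + d * v)) = (b * u < a * v).
Proof.
move=> u0 v0 /andP[d0 d1]; have dv0 : 0 <= d * v by rewrite mulr_ge0 // ltW.
rewrite ltr_pdivrMr ?addr_gt0 // mulrAC ltr_pdivlMr ?ltr_pwDl //.
rewrite -subr_gt0 -[RHS]subr_gt0.
(* After cross-multiplication the difference factors, and [1 - d] is positive. *)
rewrite (_ : _ - _ = (1 - d) * (a * v - b * u)); last by ring.
by rewrite pmulr_rgt0 // subr_gt0.
Qed.

Theorem theorem2 (R : realFieldType) (n k : nat) (hk : (1 <= k <= n)%N)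
    (S : {group pauli n}) (hS : #|S| = (2 ^ (n - k))%N)
    (hSI : minus_I n \notin S)
    (D : dual S -> pstring n) (hD : is_decoding_map D)
    (G : {group pstring n}) (hG : G :!=: 1%g)
    (pQEC pDD : R) (hQEC : pQEC = 0) (hDD : 0 <= pDD < 1)
    (p z : R) (hp : 0 < p < 1) (hz : 0 < z) (hzp : z = p / (3 - 3 * p)) :
  F_Hyb D G p pDD pQEC > F_QEC D G p pQEC <->
  W (suppressed G :\: correctable D) z / W (suppressed G) z >
  W (unsuppressed G :\: correctable D) z / W (unsuppressed G) z.
Proof.
have [_ p1] := andP hp; have [E EV] := suppressed_neq0 hG.
have u0 : 0 < W (unsuppressed G) z := W_gt0 hz (unsuppressed1 G).
have v0 : 0 < W (suppressed G) z := W_gt0 hz EV.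
(* [F_QEC] is the instance [d = 1], the left-hand fraction of [mediant_lt]. *)
rewrite hQEC /F_QEC !(F_HybE G p1 hzp hD) !mul1r mediant_lt //.
rewrite ltr_pdivrMr // mulrAC ltr_pdivlMr //.
rewrite (W_setID (unsuppressed G) (correctable D)).
rewrite (W_setID (suppressed G) (correctable D)).
(* With [u = a + a'] and [v = b + b'], both [b * u < a * v] and [a' * v < b' * u] reduce to
   [a' * b < a * b']. *)
by split; nra.
Qed.
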